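(* Let $m,n$ be two positive integers with $m=O(n^{\alpha})$ (i.e., $m\leq Cn^{\alpha}$ for some positive constant $C$), where $\alpha\in\mathbb{R}$ and $\alpha\geq 1$. For every pair of positive integers $k,\ell$ with $k\geq 3$, there exists a positive integer $N=N(k,\ell)$ such that $$rx_{k,\ell}(K_{m,n})=\begin{cases}3 & \text{if } k=3 \text{ and } \ell=1,2,\\ 4 & \text{if } k=3 \text{ and } \ell\geq 3,\\ k+1 & \text{if } k\geq 4\end{cases}$$ for every integer $n\geq N$.
   Context: All graphs are undirected, finite and simple. $K_{m,n}$ is the complete bipartite graph with vertex classes of sizes $m$ and $n$. An edge-coloring of a graph $G$ with $t$ colors is any map $c:E(G)\to\{1,\dots,t\}$ (adjacent edges may receive the same color). A tree $T$ in $G$ is a rainbow tree if no two edges of $T$ have the same color. For $S\subseteq V(G)$, an $S$-tree is a tree in $G$ connecting the vertices of $S$ (that is, containing all of them), and a rainbow $S$-tree is an $S$-tree that is a rainbow tree. Rainbow $S$-trees $T_1,\dots,T_\ell$ are internally disjoint if $E(T_i)\cap E(T_j)=\emptyset$ and $V(T_i)\cap V(T_j)=S$ for every pair of distinct integers $i,j$ with $1\le i,j\le \ell$. The $(k,\ell)$-rainbow index $rx_{k,\ell}(G)$ is the minimum number of colors needed in an edge-coloring of $G$ such that for every set $S$ of $k$ vertices of $G$ there exist $\ell$ internally disjoint rainbow $S$-trees.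
   Formalization: The formal theorem adds the assumption n ≤ m (m is the larger class), without which the claim fails, e.g. for stars K_{1,n}; the constants C and α are fixed first, so N may depend on k, ℓ, α and C. *)

(* Defs.v *)
From HB Require Import structures.
From mathcomp Require Import all_boot.

Set Implicit Arguments.
Unset Strict Implicit.
Unset Printing Implicit Defensive.

Record sgraph := SGraph {
  vertex :> finType;
  adj : rel vertex;
  adj_sym : symmetric adj;
  adj_irrefl : irreflexive adj }.

(* An edge is the two-element set of its endpoints. *)
Definition edges (G : sgraph) : {set {set G}} :=
  [set [set p.1; p.2] | p : G * G & adj p.1 p.2].

Definition bip_adj (m n : nat) : rel ('I_m + 'I_n)%type :=
  fun u v => is_inl u != is_inl v.

Lemma bip_adj_sym m n : symmetric (@bip_adj m n).
Proof. by move=> u v; rewrite /bip_adj eq_sym. Qed.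

Lemma bip_adj_irrefl m n : irreflexive (@bip_adj m n).
Proof. by move=> u; rewrite /bip_adj eqxx. Qed.

Definition complete_bipartite (m n : nat) : sgraph :=
  SGraph (@bip_adj_sym m n) (@bip_adj_irrefl m n).

(* The value of a coloring outside the edge set of G is irrelevant. *)
Definition edge_coloring (G : sgraph) (t : nat) (c : {set G} -> nat) : Prop :=
  forall e, e \in edges G -> 1 <= c e <= t.

Record subgraph (G : sgraph) := Subgraph {
  vset : {set G};
  eset : {set {set G}};
  eset_edges : eset \subset edges G;
  eset_vset : forall e, e \in eset -> e \subset vset }.

Definition sub_adj (G : sgraph) (T : subgraph G) : rel G :=
  fun x y => [set x; y] \in eset T.

Definition connected (G : sgraph) (T : subgraph G) : Prop :=
  vset T != set0 /\
  {in vset T &, forall x y, connect (sub_adj T) x y}.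

(* Two vertices joined by an edge satisfy [ucycle], so a graph cycle must
   have at least three vertices. *)
Definition acyclic (G : sgraph) (T : subgraph G) : Prop :=
  forall s : seq G, 2 < size s -> ~ ucycle (sub_adj T) s.

Definition is_tree (G : sgraph) (T : subgraph G) : Prop :=
  connected T /\ acyclic T.

Definition rainbow (G : sgraph) (c : {set G} -> nat) (T : subgraph G) : Prop :=
  {in eset T &, injective c}.

Definition rainbow_S_tree (G : sgraph) (c : {set G} -> nat) (S : {set G})
    (T : subgraph G) : Prop :=
  [/\ is_tree T, S \subset vset T & rainbow c T].

Definition internally_disjoint (G : sgraph) (S : {set G}) (l : nat)
    (T : 'I_l -> subgraph G) : Prop :=
  forall i j, i != j ->
    eset (T i) :&: eset (T j) = set0 /\ vset (T i) :&: vset (T j) = S.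

Definition rainbow_colorable (k l : nat) (G : sgraph) (t : nat) : Prop :=
  exists c : {set G} -> nat, edge_coloring t c /\
    forall S : {set G}, #|S| = k ->
      exists T : 'I_l -> subgraph G,
        (forall i, rainbow_S_tree c S (T i)) /\ internally_disjoint S T.

(* [is_rainbow_index k l G t] is the equation rx_{k,l}(G) = t.  It is a
   relation because some graphs admit no suitable coloring with any number of
   colors, and then the index is undefined. *)
Definition is_rainbow_index (k l : nat) (G : sgraph) (t : nat) : Prop :=
  rainbow_colorable k l G t /\
  forall t', rainbow_colorable k l G t' -> t <= t'.

(* Main.v *)
Require Import Defs.
From mathcomp Require Import all_boot all_order all_algebra.
From mathcomp Require Import reals exp.
From mathcomp Require Import zify.

Set Implicit Arguments.
Unset Strict Implicit.
Unset Printing Implicit Defensive.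

(* Upper bound: a coloring c of A * B is (s, r)-universal when every prescription
   of colors on at most s vertices of A is realised by a vertex of B, even after
   forbidding r vertices of B. A union bound shows that colorings universal from
   both sides exist once both classes are large and one is polynomially bounded
   in the other, and in such a coloring the trees are chosen greedily. All of
   them are double stars: with k + 1 colors, take new vertices p and q, joined to
   each other, p joined to the part of S in B and q to the part of S in A. With
   3 colors and k = 3, l = 2, take a star if S lies in one class; if
   S = {u, u', v}, take the paths v u w u' and v u' w' u.

   Lower bound: a rainbow tree with t colors has at most t + 1 vertices. For
   k >= 4 put S inside a monochromatic K_{2,k-2}: with k colors a rainbow S-tree
   has at most one vertex outside S and at most one edge inside S, hence too few
   edges. For k = 3 and l >= 3 take S = {u, u', v}: with 3 colors each S-tree uses
   the edge vu or the edge vu', so there are at most two of them. *)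

(** * Universal colorings *)

Lemma leq_exp2rW (m n e : nat) : m <= n -> m ^ e <= n ^ e.
Proof. by case: e => // e mn; rewrite leq_exp2r. Qed.

Section Counting.
Variables (A B : finType) (q : nat).

(** The bad event of the union bound. Colorings are curried with [B] first: one is a free choice of
    a function on [A] for each vertex of [B], which makes the event a product over [B]. *)
Definition avoiding (X : {set A}) (d : A -> 'I_q) (F : {set B}) :
    {set {ffun B -> {ffun A -> 'I_q}}} :=
  [set c : {ffun B -> {ffun A -> 'I_q}} |
     [forall y, (y \notin F) ==> [exists x in X, c y x != d x]]].

Lemma card_ffun_agreeing (X : {set A}) (d : A -> 'I_q) :
  #|[set g : {ffun A -> 'I_q} | [forall x in X, g x == d x]]| =
  q ^ (#|A| - #|X|).
Proof.
pose fam x : pred 'I_q := if x \in X then pred1 (d x) else predT.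
have -> : #|[set g : {ffun A -> 'I_q} | [forall x in X, g x == d x]]|
          = #|(family fam : {pred {ffun A -> 'I_q}})|.
  apply: eq_card => g; rewrite inE; apply/forall_inP/familyP => [agr x | agr x xX].
    by rewrite /fam; case: ifPn => // /agr.
  by have := agr x; rewrite /fam xX.
rewrite card_family foldrE big_map big_enum /= (bigID (mem X)) /=.
rewrite big1 ?mul1n => [|x xX]; last by rewrite /fam xX card1.
rewrite (eq_bigr (fun=> q)) => [|x xX]; last first.
  by rewrite /fam (negbTE xX) card_ord.
rewrite prod_nat_const; congr (_ ^ _).
by rewrite -(cardC X) addKn; apply: eq_card => x; rewrite !inE.
Qed.

(** At a vertex outside [F] a random function agrees with [d] on [X] with probability at least
    [q ^ -s], independently of the other vertices. So the event has probability at most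
    [(1 - q ^ -s) ^ (#|B| - r)]; denominators are cleared to stay in [nat]. *)
Lemma card_avoiding (X : {set A}) (d : A -> 'I_q) (F : {set B}) (s r : nat) :
  0 < q -> #|X| <= s -> #|F| <= r -> r <= #|B| ->
  #|avoiding X d F| * (q ^ s) ^ (#|B| - r) <=
  (q ^ #|A|) ^ #|B| * (q ^ s - 1) ^ (#|B| - r).
Proof.
move=> q0 Xs Fr rB.
pose agr := [set g : {ffun A -> 'I_q} | [forall x in X, g x == d x]].
pose fam y : {set {ffun A -> 'I_q}} := if y \in F then setT else ~: agr.
have -> : #|avoiding X d F| = #|(family fam : {pred {ffun B -> {ffun A -> 'I_q}}})|.
  apply: eq_card => c; rewrite inE; apply/forallP/familyP => avoid y;
    have:= avoid y; rewrite /fam; case: ifPn => [|yF]; rewrite ?inE //= => /existsP.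
    by case=> x /andP[xX cd]; apply/existsP; exists x; rewrite xX.
  by case=> x; rewrite negb_imply => xX; apply/existsP; exists x.
have cardT : #|{: {ffun A -> 'I_q}}| = q ^ #|A| by rewrite card_ffun card_ord.
have kE : #|~: agr| = q ^ #|A| - q ^ (#|A| - #|X|).
  by rewrite cardsCs setCK card_ffun_agreeing cardT.
rewrite card_family foldrE big_map big_enum /= (bigID (mem F)) /=.
rewrite (eq_bigr (fun=> q ^ #|A|)) => [|y yF]; last by rewrite /fam yF cardsT.
rewrite [X in _ * X * _](eq_bigr (fun=> #|~: agr|)) => [|y yF]; last first.
  by rewrite /fam (negbTE yF).
rewrite !prod_nat_const kE.
have -> : #|[pred y | y \notin F]| = #|B| - #|F|.
  by rewrite -(cardC F) addKn; apply: eq_card => y; rewrite !inE.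
set P := q ^ #|A|; set K := P - _.
have KP : K <= P by rewrite leq_subr.
have KQ : K * q ^ s <= P * (q ^ s - 1).
  rewrite mulnBl mulnBr muln1 leq_sub2l // -expnD leq_pexp2l //.
  by have := max_card (mem X); lia.
(* [F] is in effect padded to size [r]: [r - #|F|] of the factors [K] are replaced by the larger
   [P]. *)
apply: (@leq_trans (P ^ r * K ^ (#|B| - r) * (q ^ s) ^ (#|B| - r))).
  rewrite leq_mul2r; apply/orP; right.
  have -> : #|B| - #|F| = (#|B| - r) + (r - #|F|) by lia.
  have -> : P ^ r = P ^ (#|F| + (r - #|F|)) by congr (_ ^ _); lia.
  rewrite !expnD -mulnA leq_mul2l mulnC leq_mul2r leq_exp2rW ?orbT //.
have -> : P ^ #|B| = P ^ r * P ^ (#|B| - r) by rewrite -expnD; congr (_ ^ _); lia.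
by rewrite -!mulnA -!expnMn leq_mul2l; apply/orP; right; apply: leq_exp2rW.
Qed.
End Counting.

Definition universal (A B : finType) (C : Type) (s r : nat) (c : A -> B -> C) :=
  forall (X : {set A}) (d : A -> C) (F : {set B}),
    #|X| <= s -> #|F| <= r ->
    exists2 y, y \notin F & {in X, forall x, c x y = d x}.

Lemma card_bigcup_le (I T : finType) (P : I -> {set T}) (W K : nat) :
  (forall i, #|P i| * W <= K) -> #|\bigcup_i P i| * W <= #|I| * K.
Proof.
move=> PK; have -> : #|I| * K = \sum_(i : I) K by rewrite sum_nat_const.
apply: leq_trans (_ : \sum_i #|P i| * W <= _); last exact: leq_sum.
elim/big_rec2: _ => [|i n S _ le]; first by rewrite cards0.
by apply: leq_trans (leq_add (leqnn _) le); rewrite -mulnDl leq_mul2r leq_card_setU orbT.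
Qed.

(** Small sets are enlarged to ranges of functions on ['I_s], so that the union bound runs over a
    type of cardinal [#|T| ^ s]. *)
Lemma ffun_cover (T : finType) (x0 : T) (s : nat) (X : {set T}) :
  #|X| <= s -> exists f : {ffun 'I_s -> T}, X \subset [set f i | i : 'I_s].
Proof.
move=> Xs; exists [ffun i : 'I_s => nth x0 (enum X) i]; apply/subsetP => x xX.
have lt : index x (enum X) < s.
  by apply: leq_trans Xs; rewrite cardE index_mem mem_enum.
by apply/imsetP; exists (Ordinal lt); rewrite // ffunE nth_index ?mem_enum.
Qed.

Section UnionBound.
Variables (A B : finType) (x0 : A) (y0 : B) (q s r : nat).

Let coloring := {ffun B -> {ffun A -> 'I_q.+1}}.

(** [ord0] is a dummy value off the range of [x]. If [x] is not injective some index is picked,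
    which is harmless when [d] factors through [x]. *)
Definition pattern (x : {ffun 'I_s -> A}) (d : {ffun 'I_s -> 'I_q.+1}) (a : A) :=
  if [pick i | x i == a] is Some i then d i else ord0.

Definition nonuniversal : {set coloring} :=
  \bigcup_(j : {ffun 'I_s -> A} * {ffun 'I_s -> 'I_q.+1} * {ffun 'I_r -> B})
    avoiding [set j.1.1 i | i : 'I_s] (pattern j.1.1 j.1.2) [set j.2 i | i : 'I_r].

Lemma universal_notin (c : coloring) :
  c \notin nonuniversal -> universal s r (fun x y => c y x).
Proof.
move=> cN X d F Xs Fr.
have [x Xx] := ffun_cover x0 Xs; have [f Ff] := ffun_cover y0 Fr.
have : c \notin avoiding [set x i | i : 'I_s]
                 (pattern x [ffun i => d (x i)]) [set f i | i : 'I_r].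
  apply: contra cN => cav; apply/bigcupP.
  by exists (x, [ffun i => d (x i)], f).
rewrite inE negb_forall => /existsP[y]; rewrite negb_imply negb_exists.
case/andP=> yF /forallP agr; exists y.
  by apply: contra yF; apply: (subsetP Ff).
move=> a /(subsetP Xx) aX; have:= agr a; rewrite aX negbK => /eqP->.
rewrite /pattern; case: pickP => [i /eqP <-|none]; first by rewrite ffunE.
by case/imsetP: aX => i _ ai; have:= none i; rewrite ai eqxx.
Qed.

Lemma card_nonuniversal : r <= #|B| ->
  #|nonuniversal| * (q.+1 ^ s) ^ (#|B| - r) <=
  #|A| ^ s * q.+1 ^ s * #|B| ^ r * (q.+1 ^ s - 1) ^ (#|B| - r) * #|{: coloring}|.
Proof.
move=> rB.
have -> : #|A| ^ s * q.+1 ^ s * #|B| ^ r =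
  #|{: {ffun 'I_s -> A} * {ffun 'I_s -> 'I_q.+1} * {ffun 'I_r -> B}}|.
  by rewrite !card_prod !card_ffun !card_ord.
rewrite -mulnA; apply: card_bigcup_le => j.
have imle (T : finType) n (f : {ffun 'I_n -> T}) : #|[set f i | i : 'I_n]| <= n.
  by rewrite (leq_trans (leq_imset_card _ _)) // card_ord.
rewrite mulnC [X in _ <= X]mulnC !card_ffun card_ord mulnC.
exact: card_avoiding.
Qed.

(** Fewer than half of the colorings are bad, so the bad sets for the two sides cannot together
    exhaust all colorings. *)
Lemma card_nonuniversal_lt : r <= #|B| ->
  2 * (#|A| ^ s * q.+1 ^ s * #|B| ^ r * (q.+1 ^ s - 1) ^ (#|B| - r)) <
    (q.+1 ^ s) ^ (#|B| - r) ->
  2 * #|nonuniversal| < #|{: coloring}|.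
Proof.
move=> rB; have := card_nonuniversal rB.
set W := (q.+1 ^ s) ^ _; set L := _ * (_ ^ (_ - r)); set M := #|nonuniversal|.
set T := #|_| => le lt.
have T0 : 0 < T by apply/card_gt0P; exists [ffun _ => [ffun _ => ord0]].
rewrite ltnNge; apply/negP => leT.
suff: W * T < W * T by rewrite ltnn.
apply: leq_ltn_trans (_ : 2 * L * T < _); last by rewrite ltn_pmul2r.
by apply: leq_trans (_ : W * (2 * M) <= _); [rewrite leq_mul2l leT orbT | lia].
Qed.
End UnionBound.

Lemma exists_universal (A B : finType) (q s r : nat) :
  0 < #|A| -> 0 < #|B| -> r <= #|A| -> r <= #|B| ->
  2 * (#|A| ^ s * q.+1 ^ s * #|B| ^ r * (q.+1 ^ s - 1) ^ (#|B| - r)) <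
    (q.+1 ^ s) ^ (#|B| - r) ->
  2 * (#|B| ^ s * q.+1 ^ s * #|A| ^ r * (q.+1 ^ s - 1) ^ (#|A| - r)) <
    (q.+1 ^ s) ^ (#|A| - r) ->
  exists c : A -> B -> 'I_q.+1,
    universal s r c /\ universal s r (fun y x => c x y).
Proof.
move=> /card_gt0P[x0 _] /card_gt0P[y0 _] rA rB ltB ltA.
have := card_nonuniversal_lt rB ltB; have := card_nonuniversal_lt rA ltA.
set NA := nonuniversal B _ _ _ _; set NB := nonuniversal _ _ _ _ _ => cA cB.
(* Transposition is injective, so it pulls the bad set for the other side back to a set that is no
   larger, in the type where both can be compared. *)
pose tr (c : {ffun B -> {ffun A -> 'I_q.+1}}) : {ffun A -> {ffun B -> 'I_q.+1}} :=
  [ffun x => [ffun y => c y x]].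
have tr_inj : injective tr.
  move=> c c' /ffunP trE; apply/ffunP => y; apply/ffunP => x.
  by have /ffunP/(_ y) := trE x; rewrite !ffunE.
have cardE : #|{: {ffun A -> {ffun B -> 'I_q.+1}}}| =
    #|{: {ffun B -> {ffun A -> 'I_q.+1}}}|.
  by rewrite !card_ffun -!expnM mulnC.
have leA : #|tr @^-1: NA| <= #|NA|.
  rewrite -(card_imset _ tr_inj); apply/subset_leq_card/subsetP => ? /imsetP[c].
  by rewrite inE => + ->.
have /subsetPn[c _] : ~~ (setT \subset (NB :|: tr @^-1: NA)).
  apply/negP => /subset_leq_card; rewrite cardsT => leT.
  have := leq_trans (leq_trans leT (leq_card_setU _ _)) (leq_add (leqnn _) leA).
  move: cA; rewrite cardE; move: cB; set T := #|_|; set a := #|_|; set b := #|_|. lia.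
rewrite !inE negb_or => /andP[cNB cNA].
exists (fun x y => c y x); split; first exact: universal_notin cNB.
move=> X d F Xs Fr; have [y yF agr] := universal_notin y0 x0 cNA d Xs Fr.
by exists y => // x /agr; rewrite !ffunE.
Qed.

(** * Exponentials outgrow polynomials *)

Lemma exp_subn_le_bin_fact (e n : nat) : (n - e) ^ e <= 'C(n, e) * e`!.
Proof.
rewrite bin_ffact; elim: e n => [|e IH] [|n] //; rewrite ?sub0n ?exp0n //.
rewrite subSS expnS ffactSS; apply: leq_mul (IH n); lia.
Qed.

Lemma bin_exp_le (Q e n : nat) : e <= n -> 'C(n, e) * Q ^ (n - e) <= Q.+1 ^ n.
Proof.
move=> en; rewrite -addn1 expnDn (bigD1 (inord e : 'I_n.+1)) //= inordK //.
by rewrite exp1n muln1 leq_addr.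
Qed.

(** One term of the binomial expansion of [Q.+1 ^ (n - r)], the one with coefficient
    ['C(n - r, D.+1)], already outgrows the left side. *)
Lemma poly_lt_exp (Q D K r : nat) :
  exists N, forall n, N <= n -> K * n ^ D * Q ^ (n - r) < Q.+1 ^ (n - r).
Proof.
(* After division by [Q ^ (n - r - e)], [M] collects the constants: [Q ^ e] is left over, [e!]
   clears the binomial coefficient, and [2 ^ D] comes from [n <= 2 * x] with [x = n - r - e]. It
   remains to have [M < x]. *)
pose e := D.+1; pose M := K * 2 ^ D * Q ^ e * e`!.
have [->|Q0] := posnP Q.
  by exists r.+1 => n nr; rewrite exp1n exp0n ?muln0 // subn_gt0.
exists (2 * (r + e) + 2 * M + 2) => n nN.
have ern : e <= n - r by lia.
apply: leq_trans (bin_exp_le Q ern).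
rewrite -[n - r in X in X < _](subnK ern) expnD.
set x := n - r - e; have Mx : M < x by rewrite /x; lia.
rewrite mulnCA mulnC ltn_pmul2r ?expn_gt0 ?Q0 //.
rewrite -(ltn_pmul2r (fact_gt0 e)).
apply: leq_trans (exp_subn_le_bin_fact e (n - r)); rewrite -/x.
apply: leq_ltn_trans (_ : M * x ^ D < _); last first.
  by rewrite [X in _ < X]expnS ltn_pmul2r // expn_gt0; lia.
have nx : n ^ D <= 2 ^ D * x ^ D by rewrite -expnMn leq_exp2rW // /x; lia.
rewrite /M; apply: leq_trans (_ : K * (2 ^ D * x ^ D) * Q ^ e * e`! <= _); last lia.
by rewrite !leq_mul2r leq_mul2l nx !orbT.
Qed.

(** In each direction the number of prescriptions must be polynomial in the size of the class that
    realises them: [m ^ s <= n ^ (D * s)] serves one direction and [n ^ s <= m ^ s] the other. *)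
Lemma exists_universal_ord (q s r D : nat) : exists N, forall m n,
  N <= n -> n <= m -> m <= n ^ D ->
  exists c : 'I_m -> 'I_n -> 'I_q.+1,
    universal s r c /\ universal s r (fun y x => c x y).
Proof.
pose Q := q.+1 ^ s - 1.
have QE : Q.+1 = q.+1 ^ s by rewrite /Q subn1 prednK // expn_gt0.
have [N1 H1] := poly_lt_exp Q (D * s + r) (2 * q.+1 ^ s) r.
have [N2 H2] := poly_lt_exp Q (s + r) (2 * q.+1 ^ s) r.
exists (N1 + N2 + r + 1) => m n nN nm mn.
apply: exists_universal; rewrite ?card_ord; try lia.
  rewrite -/Q -QE; apply: leq_ltn_trans (H1 n _); last lia.
  rewrite mulnA leq_mul2r; apply/orP; right.
  rewrite expnD expnM; have := leq_exp2rW s mn; set a := m ^ s; set b := _ ^ s.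
  set d := q.+1 ^ s; set e := n ^ r => ab.
  by have := leq_mul (leqnn (2 * d * e)) ab; lia.
rewrite -/Q -QE; apply: leq_ltn_trans (H2 m _); last lia.
rewrite mulnA leq_mul2r; apply/orP; right.
rewrite expnD; have := leq_exp2rW s nm; set a := n ^ s; set b := _ ^ s.
set d := q.+1 ^ s; set e := m ^ r => ab.
by have := leq_mul (leqnn (2 * d * e)) ab; lia.
Qed.

(** * Packings of double stars *)

Section DoubleStars.
Variables A B : finType.
Implicit Types (p : A) (q : B) (X : {set A}) (Y : {set B}).

(** Edges are kept as pairs over arbitrary finite types, so that the two classes can be exchanged.
    Stars ([Y] reduced to [q]) and paths with three edges are special cases. *)
Definition double_star p q X Y : {set A * B} :=
  [set z | [&& z.1 \in X, z.2 \in Y & (z.1 == p) || (z.2 == q)]].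

Lemma in_double_star p q X Y a b :
  ((a, b) \in double_star p q X Y) =
  [&& a \in X, b \in Y & (a == p) || (b == q)].
Proof. by rewrite inE. Qed.

(** A center may itself lie in [SA] or [SB], as happens in the three-color packings. *)
Definition spanning_star (C : Type) (c : A -> B -> C) (SA : {set A}) (SB : {set B})
    p q X Y :=
  [/\ p \in X, q \in Y, SA \subset X, SB \subset Y &
     {in double_star p q X Y &, injective (fun z => c z.1 z.2)}].

Definition packing (C : Type) (c : A -> B -> C) (SA : {set A}) (SB : {set B})
    (l : nat) :=
  exists (p : 'I_l -> A) (q : 'I_l -> B) (X : 'I_l -> {set A}) (Y : 'I_l -> {set B}),
    (forall i, spanning_star c SA SB (p i) (q i) (X i) (Y i)) /\
    (forall i j, i != j ->
       [/\ [disjoint double_star (p i) (q i) (X i) (Y i)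
                   & double_star (p j) (q j) (X j) (Y j)],
           X i :&: X j = SA & Y i :&: Y j = SB]).

Lemma packing_le (C : Type) (c : A -> B -> C) SA SB l l' :
  l' <= l -> packing c SA SB l -> packing c SA SB l'.
Proof.
move=> le [p [q [X [Y [H1 H2]]]]]; pose w := widen_ord le.
exists (p \o w), (q \o w), (X \o w), (Y \o w).
by split=> [i|i j ij]; [exact: H1 | exact: H2].
Qed.
End DoubleStars.

Lemma packing_sym (A B : finType) (C : Type) (c : A -> B -> C) SA SB l :
  packing (fun y x => c x y) SB SA l -> packing c SA SB l.
Proof.
move=> [q [p [Y [X [H1 H2]]]]]; exists p, q, X, Y.
have swapE p' q' X' Y' (z : A * B) : (z \in double_star p' q' X' Y') =
    ((z.2, z.1) \in double_star q' p' Y' X').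
  by rewrite !inE /= andbCA orbC.
split=> [i|i j /H2[dis -> ->]].
  have [qY pX SY SX inj] := H1 i; split=> // -[a b] [a' b'].
  by rewrite !swapE => z1 z2 /= /(inj (b, a) (b', a') z1 z2) [-> ->].
split=> //; apply/pred0P => z /=; have /pred0P/(_ (z.2, z.1)) /= := dis.
by rewrite !swapE.
Qed.

Lemma greedy_choice (T : eqType) (P : T -> Prop) (R : rel T) (l : nat) :
  symmetric R ->
  (forall s, size s < l -> exists2 x, P x & all (R x) s) ->
  exists t : 'I_l -> T, (forall i, P (t i)) /\ forall i j, i != j -> R (t i) (t j).
Proof.
move=> Rsym ext.
have [s sz [Ps Rs]] : exists2 s, size s = l & (forall x, x \in s -> P x) /\ pairwise R s.
  elim: l ext => [|l IH] ext; first by exists [::].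
  have [s sz [Ps Rs]] := IH (fun s lt => ext s (ltnW lt)).
  have [|x Px Rx] := ext s; first by rewrite sz.
  exists (x :: s); first by rewrite /= sz.
  by split; rewrite /= ?Rx // => y; rewrite inE => /predU1P[->|/Ps].
case: l sz {ext} => [|l] sz.
  (* For [l = 0] the type [T] may be empty, so no default element for [nth] is available. *)
  by exists (fun i : 'I_0 => match notF (ltn_ord i) with end); split=> -[].
have [x0] : exists x0 : T, true by case: s sz {Ps Rs} => // x; exists x.
exists (fun i => nth x0 s i); split=> [i|i j ij]; first by apply: Ps; rewrite mem_nth ?sz.
have Rlt (i' j' : 'I_l.+1) : i' < j' -> R (nth x0 s i') (nth x0 s j').
  by move=> lt; move/pairwiseP: Rs; apply; rewrite ?inE ?sz.
by case: (ltngtP i j) => [/Rlt|/Rlt|/val_inj/eqP]; rewrite ?(negbTE ij) // Rsym.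
Qed.

Section PackingUniversal.
Variables A B : finType.

Definition left_part (S : {set A + B}) : {set A} := [set a | inl a \in S].
Definition right_part (S : {set A + B}) : {set B} := [set b | inr b \in S].

Lemma card_parts S : #|left_part S| + #|right_part S| = #|S|.
Proof.
rewrite -(card_imset _ (@inl_inj A B)) -(card_imset (mem (right_part S)) (@inr_inj A B)).
set L := [set _ | _ in left_part S]; set R := imset _ _.
have LR : [disjoint L & R].
  by apply/pred0P => z /=; apply/negP => /andP[/imsetP[a _ ->] /imsetP[]].
rewrite -(eqTleqif (leq_card_setU L R) LR); apply: eq_card => -[a|b].
  rewrite !inE; apply/orP/idP => [[/imsetP[a' + [->]]|/imsetP[]] //|aS].
    by rewrite inE.
  by left; apply/imsetP; exists a; rewrite ?inE.
rewrite !inE; apply/orP/idP => [[/imsetP[]|/imsetP[b' + [->]]] //|bS].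
  by rewrite inE.
by right; apply/imsetP; exists b; rewrite ?inE.
Qed.

(** Each vertex of [S] is a leaf whose edge gets a color of its own, and the edge between the
    centers gets the remaining color. The stars are built one after another with fresh centers; at
    most [k + l] vertices, namely those of [S] and the earlier centers, have to be avoided. *)
Lemma packing_universal (k l : nat) (c : A -> B -> 'I_k.+1) (S : {set A + B}) :
  #|S| = k -> universal k.+1 (k + l) c -> universal k.+1 (k + l) (fun y x => c x y) ->
  packing c (left_part S) (right_part S) l.
Proof.
move=> Sk Uc Uc'; set SA := left_part S; set SB := right_part S.
have SAB : #|SA| + #|SB| = k by rewrite card_parts.
(* Ranks in [S] use the colors below [k]; [ord_max] is reserved for the edge between the centers. *)
pose h z : 'I_k.+1 := inord (index z (enum S)).
have hlt z : z \in S -> index z (enum S) < k.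
  by move=> zS; rewrite -Sk cardE index_mem mem_enum.
have h_inj : {in S &, injective h}.
  move=> z z' zS z'S /(congr1 val); rewrite /= !inordK ?ltnS ?(ltnW (hlt _ _)) // => eqi.
  by rewrite -(nth_index z (s := enum S) (x := z)) ?mem_enum // eqi nth_index ?mem_enum.
have h_max z : z \in S -> h z != ord_max.
  by move=> zS; rewrite -val_eqE /= inordK ?ltnS ?(ltnW (hlt _ _)) // ltn_eqF ?hlt.
pose good (z : A * B) := [/\ z.1 \notin SA, z.2 \notin SB, c z.1 z.2 = ord_max,
  {in SA, forall a, c a z.2 = h (inl a)} & {in SB, forall b, c z.1 b = h (inr b)}].
pose apart (z z' : A * B) := (z.1 != z'.1) && (z.2 != z'.2).
have apart_sym : symmetric apart by move=> z z'; rewrite /apart eq_sym (eq_sym z.2).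
have [s sl|t [tgood tapart]] := @greedy_choice _ good apart l apart_sym.
  have seq_le (T : finType) (f : A * B -> T) (F : {set T}) : #|F| <= k ->
      #|F :|: [set x in map f s]| <= k + l.
    move=> Fk; apply: leq_trans (leq_card_setU _ _) (leq_add Fk _).
    by rewrite cardsE (leq_trans (card_size _)) // size_map ltnW.
  (* [p] is chosen before [q], so that the prescription for [q] can include the color of the edge to
     [p]; hence up to [k.+1] prescribed values. *)
  have [||p pF pc] := Uc' SB (fun b => h (inr b)) (SA :|: [set x in map fst s]); try lia.
    by apply: seq_le; lia.
  have [||q qF qc] := Uc (p |: SA) (fun a => if a == p then ord_max else h (inl a))
                        (SB :|: [set x in map snd s]).
  - by rewrite cardsU1; lia.
  - by apply: seq_le; lia.
  move: pF qF; rewrite !inE !negb_or => /andP[pS ps] /andP[qS qs].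
  exists (p, q).
    split; rewrite ?inE //=.
    + by rewrite qc ?setU11 ?eqxx.
    + by move=> a aS; rewrite qc ?setU1r ?ifN //;
         apply: contraNneq pS => <-; rewrite inE in aS.
  apply/allP => z zs; rewrite /apart /=; apply/andP; split.
    by apply: contraNneq ps => ->; apply: map_f.
  by apply: contraNneq qs => ->; apply: map_f.
exists (fun i => (t i).1), (fun i => (t i).2),
  (fun i => (t i).1 |: SA), (fun i => (t i).2 |: SB).
split=> [i|i j ij].
  rewrite /spanning_star !setU11 !subsetUr; split=> //.
  case: (t i) (tgood i) => p q [/= pS qS cpq cA cB].
  have colE a b : (a, b) \in double_star p q (p |: SA) (q |: SB) ->
     [\/ [/\ a = p, b = q & c a b = ord_max],
         [/\ a \in SA, b = q & c a b = h (inl a)] |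
         [/\ a = p, b \in SB & c a b = h (inr b)]].
    rewrite in_double_star !in_setU1 => /and3P[/predU1P[->|aS] /predU1P[->|bS] H].
    + by constructor 1.
    + by constructor 3; rewrite cB.
    + by constructor 2; rewrite cA.
    + case/orP: H => /eqP E; first by rewrite -E aS in pS.
      by rewrite -E bS in qS.
  have inA a : a \in SA -> inl a \in S by rewrite inE.
  have inB b : b \in SB -> inr b \in S by rewrite inE.
  move=> [a b] [a' b'] /colE[[-> -> ->]|[/inA aS -> ->]|[-> /inB bS ->]]
    /colE[[-> -> ->]|[/inA aS' -> ->]|[-> /inB bS' ->]] //=.
  - by move/esym/eqP; rewrite (negbTE (h_max _ _)).
  - by move/esym/eqP; rewrite (negbTE (h_max _ _)).
  - by move/eqP; rewrite (negbTE (h_max _ _)).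
  - by move/h_inj => /(_ aS aS') [->].
  - by move/h_inj => /(_ aS bS').
  - by move/eqP; rewrite (negbTE (h_max _ _)).
  - by move/h_inj => /(_ bS aS').
  - by move/h_inj => /(_ bS bS') [->].
have /andP[n1 n2] := tapart i j ij.
have [pS qS _ _ _] := tgood i; have [pS' qS' _ _ _] := tgood j.
have IA : ((t i).1 |: SA) :&: ((t j).1 |: SA) = SA.
  rewrite -setUIl; suff -> : [set (t i).1] :&: [set (t j).1] = set0 by rewrite set0U.
  by apply/setP => x; rewrite !inE; case: eqP => // ->; rewrite (negbTE n1).
have IB : ((t i).2 |: SB) :&: ((t j).2 |: SB) = SB.
  rewrite -setUIl; suff -> : [set (t i).2] :&: [set (t j).2] = set0 by rewrite set0U.
  by apply/setP => x; rewrite !inE; case: eqP => // ->; rewrite (negbTE n2).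
(* A common edge would have both ends in [S], but every edge of a star contains a center, and the
   centers are outside [S]. *)
split=> //; apply/pred0P => -[a b] /=; apply/negP; rewrite !in_double_star.
case/andP=> /and3P[ai bi H] /and3P[aj bj _].
have aS : a \in SA by rewrite -IA inE ai.
have bS : b \in SB by rewrite -IB inE bi.
by case/orP: H => /eqP E; [rewrite -E aS in pS | rewrite -E bS in qS].
Qed.
End PackingUniversal.

Section ThreeColors.
Variables A B : finType.
Implicit Types c : A -> B -> 'I_3.

Lemma packing_pair c SA SB p q X Y p' q' X' Y' :
  spanning_star c SA SB p q X Y -> spanning_star c SA SB p' q' X' Y' ->
  [disjoint double_star p q X Y & double_star p' q' X' Y'] ->
  X :&: X' = SA -> Y :&: Y' = SB -> packing c SA SB 2.
Proof.
move=> H H' D XX YY; pose pick T (u v : T) (i : 'I_2) := if i == ord0 then u else v.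
exists (pick _ p p'), (pick _ q q'), (pick _ X X'), (pick _ Y Y').
split=> [i|i j ij]; rewrite /pick; first by case: eqP.
move: i j ij => [[|[|//]] ?] [[|[|//]] ?] //= _.
by rewrite disjoint_sym setIC (setIC Y').
Qed.

Lemma packing_one_side c (SA : {set A}) :
  #|SA| = 3 -> universal 3 2 c -> packing c SA set0 2.
Proof.
move=> SA3 Uc; pose h a : 'I_3 := inord (index a (enum SA)).
have h_inj : {in SA &, injective h}.
  have hlt a : a \in SA -> index a (enum SA) < 3.
    by move=> aS; rewrite -SA3 cardE index_mem mem_enum.
  move=> a a' aS a'S /(congr1 val); rewrite /= !inordK ?hlt // => eqi.
  by rewrite -(nth_index a (s := enum SA) (x := a)) ?mem_enum // eqi nth_index ?mem_enum.
(* With [Y] a singleton, every choice of [p] gives the same edges, those of the star around the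
   other center. *)
have [p pSA] : exists p, p \in SA by apply/card_gt0P; rewrite SA3.
have [||q _ qh] := Uc SA h set0; rewrite ?SA3 ?cards0 //.
have [||q' + qh'] := Uc SA h [set q]; rewrite ?SA3 ?cards1 // inE => q'q.
have star y : {in SA, forall a, c a y = h a} -> spanning_star c SA set0 p y SA [set y].
  move=> yh; split; rewrite ?sub0set ?set11 // => -[a b] [a' b'].
  rewrite !in_double_star !inE => /and3P[aS /eqP-> _] /and3P[a'S /eqP-> _] /=.
  by rewrite !yh // => /h_inj->.
apply: (packing_pair (star q qh) (star q' qh')); rewrite ?setIid //.
  apply/pred0P => -[a b] /=; rewrite !in_double_star !inE.
  by apply/negP => /andP[/and3P[_ /eqP-> _] /and3P[_]]; rewrite eq_sym (negbTE q'q).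
by apply/setP => y; rewrite !inE; case: eqP => // ->; rewrite eq_sym (negbTE q'q).
Qed.

Lemma other_colors (d : 'I_3) : exists e e', uniq [:: d; e; e'].
Proof.
by exists (inord (d.+1 %% 3)), (inord (d.+2 %% 3)); move: d => [[|[|[|//]]] ?];
  rewrite /= !inE -!val_eqE /= !inordK.
Qed.

(** The color of the edge from [v] to the first center is given, so [w] is asked to show the two
    other colors to [u] and [u']. The second path enters from [v] through [u'] instead of [u] and
    has a new vertex [w'], hence shares no edge with the first. *)
Lemma packing_mixed c (SA : {set A}) (SB : {set B}) :
  #|SA| = 2 -> #|SB| = 1 -> universal 3 2 c -> packing c SA SB 2.
Proof.
move=> /eqP/cards2P[u [u' [uu' ->]]] /eqP/cards1P[v ->] Uc.
have star x x' (F : {set B}) : x != x' -> #|F| <= 2 -> v \in F ->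
    exists2 w, w \notin F &
      spanning_star c [set x; x'] [set v] x w [set x; x'] [set v; w].
  move=> xx' F2 vF; have [e [e']] := other_colors (c x v).
  rewrite /= !inE negb_or andbT => /andP[/andP[de de'] ee'].
  have [||w wF wc] := Uc [set x; x'] (fun a => if a == x then e else e') F => //.
    by rewrite cards2; case: eqP.
  exists w => //; split; rewrite ?set21 ?set22 // ?sub1set ?set21 //.
  have wx : c x w = e by rewrite wc ?set21 ?eqxx.
  have wx' : c x' w = e' by rewrite wc ?set22 // eq_sym (negbTE xx').
  have mem a b : (a, b) \in double_star x w [set x; x'] [set v; w] ->
      [\/ (a, b) = (x, v), (a, b) = (x, w) | (a, b) = (x', w)].
    rewrite in_double_star !inE.
    case/and3P=> /orP[]/eqP-> /orP[]/eqP-> H;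
      try by [constructor 1 | constructor 2 | constructor 3].
    case/orP: H => /eqP E; first by rewrite E eqxx in xx'.
    by rewrite -E vF in wF.
  move=> [a b] [a' b'] /mem[]-> /mem[]-> //=; rewrite ?wx ?wx' => /eqP;
    by rewrite ?(negbTE de) ?(negbTE de') ?(negbTE ee') // eq_sym
      ?(negbTE de) ?(negbTE de') ?(negbTE ee').
have [|||w + st] := star u u' [set v]; rewrite ?cards1 ?set11 // inE => wv.
have [|||w' + st'] := star u' u [set v; w]; [by rewrite eq_sym| |by rewrite set21|].
  by rewrite cards2; case: eqP.
rewrite !inE negb_or => /andP[w'v w'w].
rewrite (setUC [set u'] [set u]) in st'.
apply: (packing_pair st st'); rewrite ?setIid //.
  apply/pred0P => -[a b] /=; apply/negP; rewrite !in_double_star !inE.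
  case/andP=> /and3P[_ /orP[]/eqP-> au] /and3P[_]; last first.
    by rewrite (negbTE wv) eq_sym (negbTE w'w).
  move=> _; rewrite !(eq_sym v) (negbTE w'v) orbF; move: au.
  rewrite eq_sym (eq_sym v) (negbTE wv) orbF.
  by move/eqP => <-; rewrite (negbTE uu').
by apply/setP => y; rewrite !inE; case: (y =P v) => //= _; case: eqP => // ->;
  rewrite eq_sym (negbTE w'w).
Qed.
End ThreeColors.

Lemma packing_three_colors (A B : finType) (c : A -> B -> 'I_3) (S : {set A + B}) :
  #|S| = 3 -> universal 3 2 c -> universal 3 2 (fun y x => c x y) ->
  packing c (left_part S) (right_part S) 2.
Proof.
move=> S3 Uc Uc'; have := card_parts S; rewrite S3.
have : #|left_part S| <= 3 by have := card_parts S; lia.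
case E : #|left_part S| => [|[|[|[|//]]]] _ E'.
- rewrite (cards0_eq E); apply: packing_sym.
  by apply: packing_one_side => //; lia.
- by apply: packing_sym; apply: packing_mixed => //; lia.
- by apply: packing_mixed => //; lia.
- have -> : right_part S = set0 by apply: cards0_eq; lia.
  exact: packing_one_side.
Qed.

(** * Double stars as trees *)

Section DoubleStarTrees.
Variables m n : nat.
Let G := complete_bipartite m n.

Definition bip_edge (z : 'I_m * 'I_n) : {set G} := [set inl z.1; inr z.2].

Lemma in_bip_edge (z : 'I_m * 'I_n) (x : G) :
  (x \in bip_edge z) = match x with inl a => a == z.1 | inr b => b == z.2 end.
Proof. by case: x => ?; rewrite !inE ?orbF. Qed.

Lemma bip_edge_inj : injective bip_edge.
Proof.
move=> [a b] [a' b'] /setP E; have := E (inl a); have := E (inr b).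
by rewrite !in_bip_edge /= !eqxx => /esym bb /esym aa; rewrite (eqP aa) (eqP bb).
Qed.

Lemma bip_edge_edges z : bip_edge z \in edges G.
Proof. by apply/imsetP; exists ((inl z.1, inr z.2) : G * G); rewrite ?inE. Qed.

Lemma edgesP e : reflect (exists z, e = bip_edge z) (e \in edges G).
Proof.
apply: (iffP imsetP) => [[[x y]]|[z ->]].
  rewrite inE; case: x y => [a|b] [a'|b'] // _ ->; first by exists (a, b').
  by exists (a', b); rewrite /bip_edge setUC.
by exists ((inl z.1, inr z.2) : G * G); rewrite ?inE.
Qed.

Lemma sub_adjC (T : subgraph G) : symmetric (sub_adj T).
Proof. by move=> x y; rewrite /sub_adj setUC. Qed.

Lemma sub_adj_sides (T : subgraph G) x y : sub_adj T x y -> is_inl x != is_inl y.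
Proof.
move=> /(subsetP (eset_edges T))/edgesP[z /setP E].
move: x y E => [a|b] [a'|b'] E //.
  by have := E (inr z.2); rewrite in_bip_edge eqxx !inE.
by have := E (inl z.1); rewrite in_bip_edge eqxx !inE.
Qed.

Section Tree.
Variables (p : 'I_m) (q : 'I_n) (X : {set 'I_m}) (Y : {set 'I_n}).
Hypotheses (pX : p \in X) (qY : q \in Y).

Definition star_vset : {set G} :=
  [set x | match x with inl a => a \in X | inr b => b \in Y end].
Definition star_eset : {set {set G}} := bip_edge @: double_star p q X Y.

Lemma star_eset_edges : star_eset \subset edges G.
Proof. by apply/subsetP => _ /imsetP[z _ ->]; apply: bip_edge_edges. Qed.

Lemma star_eset_vset e : e \in star_eset -> e \subset star_vset.
Proof.
move=> /imsetP[[a b]]; rewrite in_double_star => /and3P[aX bY _] ->.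
by apply/subsetP => x; rewrite in_bip_edge inE; case: x => ? /eqP->.
Qed.

Definition star_tree : subgraph G := Subgraph star_eset_edges star_eset_vset.

Lemma star_adjE (a : 'I_m) (b : 'I_n) :
  sub_adj star_tree (inl a) (inr b) = ((a, b) \in double_star p q X Y).
Proof. exact: (mem_imset (double_star p q X Y) (a, b) bip_edge_inj). Qed.

Lemma star_connected : connected star_tree.
Proof.
split; first by apply/set0Pn; exists (inl p); rewrite inE.
have to_q x : x \in vset star_tree -> connect (sub_adj star_tree) (inr q) x.
  rewrite inE; case: x => [a aX|b bY].
    by apply: connect1; rewrite sub_adjC star_adjE in_double_star aX qY eqxx orbT.
  apply: (connect_trans (y := inl p)); apply: connect1.
    by rewrite sub_adjC star_adjE in_double_star pX qY eqxx.
  by rewrite star_adjE in_double_star pX bY eqxx.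
move=> x y xT yT; apply: connect_trans (to_q y yT).
by rewrite (sym_connect_sym (@sub_adjC _)); apply: to_q.
Qed.

(* Every vertex other than the two centers has a single neighbor, so it lies
   on no cycle. *)
Lemma star_acyclic : acyclic star_tree.
Proof.
move=> s s3 scyc.
have center x y z : y != z -> sub_adj star_tree x y -> sub_adj star_tree x z ->
    x \in [:: inl p; inr q : G].
  case: x => [a|b] yz xy xz; have := sub_adj_sides xy; have := sub_adj_sides xz.
    case: y z yz xy xz => [?|b] [?|b'] // bb'.
    rewrite !star_adjE !in_double_star !inE => /and3P[_ _ +] /and3P[_ _ +].
    case: (a =P p) => [->|_] /=; first by rewrite eqxx.
    by move=> /eqP E /eqP E'; rewrite E E' eqxx in bb'.
  case: y z yz xy xz => [a|?] [a'|?] // aa'.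
  rewrite 2!(sub_adjC _ (inr b)) !star_adjE !in_double_star !inE.
  move=> /and3P[_ _ +] /and3P[_ _ +]; case: (b =P q) => [->|_] /=; first by rewrite eqxx.
  by rewrite !orbF => /eqP E /eqP E'; rewrite E E' eqxx in aa'.
suff sub : {subset s <= [:: inl p; inr q : G]}.
  have := uniq_leq_size (ucycle_uniq scyc) sub; by rewrite leqNgt s3.
(* Once the cycle is rotated to start at [x], the second and the last vertex are two neighbors of
   [x], distinct because a cycle has no repetition and more than two vertices. *)
move=> x /rot_to[i s' E].
have : ucycle (sub_adj star_tree) (x :: s') by rewrite -E rot_ucycle.
have : 2 < size (x :: s') by rewrite -E size_rot.
case: s' {E} => [|y [|z s']] // _; rewrite /ucycle /= => /andP[].
rewrite rcons_path => /and4P[xy _ _ lx] /and4P[_ + _ _] => ynotin.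
apply: (center x y (last z s')) => //; last by rewrite sub_adjC.
by apply: contraNneq ynotin => ->; rewrite mem_last.
Qed.
End Tree.

Lemma rainbow_colorable_packing (k l t : nat) (c : 'I_m -> 'I_n -> 'I_t) :
  (forall S : {set 'I_m + 'I_n}, #|S| = k ->
     packing c (left_part S) (right_part S) l) ->
  rainbow_colorable k l G t.
Proof.
move=> pack.
(* Colors are shifted by one, since those of an [edge_coloring] start at 1; sets that are not edges
   get 0. *)
pose col (e : {set G}) : nat :=
  if [pick z | e == bip_edge z] is Some z then (c z.1 z.2).+1 else 0.
have colE z : col (bip_edge z) = (c z.1 z.2).+1.
  rewrite /col; case: pickP => [z' /eqP/bip_edge_inj->//|/(_ z)].
  by rewrite eqxx.
exists col; split=> [e /edgesP[z ->]|S /pack[p [q [X [Y [H1 H2]]]]]].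
  by rewrite colE ltn_ord.
exists (fun i => star_tree (p i) (q i) (X i) (Y i)); split=> [i|i j /H2[dis XX YY]].
  have [pX qY SX SY inj] := H1 i; split.
  - by split; [apply: star_connected | apply: star_acyclic].
  - apply/subsetP => -[a|b] xS; rewrite inE.
      by apply: (subsetP SX); rewrite inE.
    by apply: (subsetP SY); rewrite inE.
  - move=> _ _ /imsetP[z zD ->] /imsetP[z' z'D ->]; rewrite !colE => -[/val_inj E].
    by congr bip_edge; apply: inj.
split.
  apply/eqP; rewrite -subset0; apply/subsetP => e; rewrite inE.
  case/andP=> /imsetP[z zi ->]; rewrite mem_imset; last exact: bip_edge_inj.
  by move=> zj; have /pred0P/(_ z) := dis; rewrite /= zi zj.
apply/setP => -[a|b]; rewrite !inE.
  by have /setP/(_ a) := XX; rewrite !inE.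
by have /setP/(_ b) := YY; rewrite !inE.
Qed.
End DoubleStarTrees.

(** * Lower bounds *)

Section ConnectedSubgraphs.
Variables (G : sgraph) (T : subgraph G).
Hypothesis conT : connected T.

(** The edge is the first one that leaves [W] on a path from [x] to [y]. *)
Lemma connected_exit (W : {set G}) x y :
  x \in vset T -> y \in vset T -> x \in W -> y \notin W ->
  exists a b, [/\ a \in W, b \notin W & sub_adj T a b].
Proof.
move=> xT yT; have [_ /(_ x y xT yT)/connectP[s]] := conT.
elim: s x {xT} => [|z s IH] x /=; first by move=> _ -> ->.
case/andP=> xz path_s last_s xW yW; have [zW|zW] := boolP (z \in W).
  exact: IH path_s last_s zW yW.
by exists x, z.
Qed.

Lemma sub_adj_vset x y : sub_adj T x y -> x \in vset T /\ y \in vset T.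
Proof.
by move=> /eset_vset/subsetP sub; split; apply: sub; rewrite !inE eqxx ?orbT.
Qed.

Lemma connected_neighbor x y :
  x \in vset T -> y \in vset T -> x != y -> exists2 z, z \in vset T & sub_adj T x z.
Proof.
move=> xT yT xy; have [||a [z [/set1P-> _ xz]]] := connected_exit (W := [set x]) xT yT.
- by rewrite inE.
- by rewrite inE eq_sym.
by exists z => //; have [] := sub_adj_vset xz.
Qed.

(** A set of vertices is grown from [r] by exit edges. Each exit edge is new, because it has an end
    outside the current set while the earlier edges lie inside. *)
Lemma connected_card : #|vset T| <= (#|eset T|).+1.
Proof.
have [/set0Pn[r rT] _] := conT.
suff grow k : k < #|vset T| -> exists (W : {set G}) (F : {set {set G}}),
    [/\ r \in W, W \subset vset T, #|W| = k.+1 &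
        [/\ F \subset eset T, #|F| = k & forall e, e \in F -> e \subset W]].
  have V0 : 0 < #|vset T| by apply/card_gt0P; exists r.
  have [|W [F [_ _ _ [/subset_leq_card + FE _]]]] := grow #|vset T|.-1; first lia.
  by rewrite FE; lia.
elim: k => [|k IH] lt.
  exists [set r], set0; rewrite set11 sub1set cards1 cards0 sub0set.
  by split=> //; split=> // e; rewrite inE.
have [W [F [rW WT Wk [FT Fk FW]]]] := IH (ltnW lt).
have [y yT yW] : exists2 y, y \in vset T & y \notin W.
  by apply/subsetPn; apply/negP => /subset_leq_card; lia.
have [a [b [aW bW ab]]] := connected_exit rT yT rW yW.
exists (b |: W), ([set a; b] |: F).
have [_ bT] := sub_adj_vset ab.
rewrite setU1r // subUset sub1set bT WT cardsU1 bW Wk; split=> //.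
rewrite subUset sub1set FT andbT cardsU1 Fk; split=> //.
  case: (boolP (_ \in F)) => // /FW/subsetP/(_ b); rewrite !inE eqxx orbT => /(_ isT).
  by rewrite (negbTE bW).
move=> e; rewrite !inE => /predU1P[->|/FW eW]; last exact: subset_trans eW (subsetUr _ _).
by apply/subsetP => x; rewrite !inE => /orP[]/eqP->; rewrite ?eqxx ?aW ?orbT.
Qed.
End ConnectedSubgraphs.

Lemma rainbow_card (G : sgraph) (t : nat) (c : {set G} -> nat) (T : subgraph G) :
  edge_coloring t c -> rainbow c T -> #|eset T| <= t.
Proof.
move=> ct inj; rewrite cardE -(size_map c) -[X in _ <= X](size_iota 1).
apply: uniq_leq_size.
  by rewrite map_inj_in_uniq ?enum_uniq // => x y; rewrite !mem_enum; apply: inj.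
move=> _ /mapP[e + ->]; rewrite mem_enum mem_iota => /(subsetP (eset_edges T))/ct.
by rewrite add1n ltnS.
Qed.

Lemma rainbow_colorable_le (k l l' t : nat) (G : sgraph) :
  l' <= l -> rainbow_colorable k l G t -> rainbow_colorable k l' G t.
Proof.
move=> le [c [ct col]]; exists c; split=> // S /col[T [HT dis]].
exists (fun i => T (widen_ord le i)); split=> [i|i j ij]; first exact: HT.
exact: dis.
Qed.

Lemma exists_subset_card (T : finType) (A : {set T}) (j : nat) :
  j <= #|A| -> exists2 B : {set T}, B \subset A & #|B| = j.
Proof.
move=> jA; exists [set x in take j (enum A)].
  by apply/subsetP => x; rewrite inE => /mem_take; rewrite mem_enum.
rewrite cardsE; have/card_uniqP -> := take_uniq j (enum_uniq A).
by rewrite size_takel // -cardE.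
Qed.

Section LowerBounds.
Variables m n : nat.
Let G := complete_bipartite m n.

(** Take [S] inside one class. Two colors allow at most two edges and three vertices, so the tree
    would live on [S], which spans no edge. *)
Lemma three_le_index (l t : nat) :
  2 < m -> 0 < l -> rainbow_colorable 3 l G t -> 3 <= t.
Proof.
move=> m3 l0 /(rainbow_colorable_le l0)[c [ct col]].
have [U _ U3] : exists2 U : {set 'I_m}, U \subset setT & #|U| = 3.
  by apply: exists_subset_card; rewrite cardsT card_ord.
have [|T [/(_ ord0)[[conT _] ST rT] _]] := col [set inl u | u in U].
  by rewrite card_imset //; apply: inl_inj.
have := connected_card conT; have := rainbow_card ct rT.
rewrite leqNgt => et vt; apply/negP => t3.
have VS : vset (T ord0) = [set inl u | u in U].
  apply/esym/eqP; rewrite eqEcard ST card_imset ?U3; last exact: inl_inj.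
  by lia.
have /card_gt1P[u [v [uU vU uv]]] : 1 < #|U| by rewrite U3.
have [|||z] := @connected_neighbor _ _ conT (inl u) (inl v).
- by rewrite VS imset_f.
- by rewrite VS imset_f.
- by [].
by rewrite VS => /imsetP[w _ ->] /sub_adj_sides.
Qed.

(** If a tree avoids both edges from [v] to [u1] and [u2], then [v] has another neighbor [a] and
    [u1] has a neighbor [b] other than [v]. These make five vertices, which needs four colors. With
    three trees, two use the same edge at [v]. *)
Lemma four_le_index (l t : nat) :
  1 < m -> 0 < n -> 2 < l -> rainbow_colorable 3 l G t -> 4 <= t.
Proof.
move=> m2 n0 l3 /(rainbow_colorable_le l3)[c [ct col]].
rewrite leqNgt; apply/negP => t3.
pose u1 : 'I_m := Ordinal (ltnW m2); pose u2 : 'I_m := Ordinal m2.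
pose v : 'I_n := Ordinal n0.
pose S : {set G} := [set inl u1; inl u2; inr v].
have [|T [tree dis]] := col S.
  by rewrite /S -setUA cardsU1 cards2 !inE.
have uses i : sub_adj (T i) (inr v) (inl u1) || sub_adj (T i) (inr v) (inl u2).
  apply: contraT; rewrite negb_or => /andP[n1 n2].
  have [[conT _] /subsetP ST rT] := tree i.
  have u1T : inl u1 \in vset (T i) by apply: ST; rewrite !inE eqxx.
  have u2T : inl u2 \in vset (T i) by apply: ST; rewrite !inE eqxx ?orbT.
  have vT : inr v \in vset (T i) by apply: ST; rewrite !inE eqxx ?orbT.
  have [|z zT vz] := @connected_neighbor _ _ conT (inr v) (inl u1) vT u1T; first by [].
  have [|y yT uy] := @connected_neighbor _ _ conT (inl u1) (inr v) u1T vT; first by [].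
  have := sub_adj_sides uy; have := sub_adj_sides vz.
  case: z zT vz => [a|?] // aT va _; case: y yT uy => [?|b] // bT ub _.
  have ba : (inr b : G) \notin [:: inr v; inl u1; inl u2; inl a : G].
    rewrite !inE !orbF; apply: contraTneq ub => -[->]; by rewrite sub_adjC.
  have uniq4 : uniq [:: inr b; inr v; inl u1; inl u2; inl a : G].
    rewrite cons_uniq ba /= !inE /= andbT; apply/andP; split.
      by apply: contraNneq n1 => ->.
    by apply: contraNneq n2 => ->.
  have sub : {subset [:: inr b; inr v; inl u1; inl u2; inl a : G] <= vset (T i)}.
    by move=> x; rewrite !inE => /or4P[| | |/orP[]]/eqP->.
  have := uniq_leq_size uniq4 (s2 := enum (vset (T i))); rewrite -cardE /= => le.
  have := connected_card conT; have := rainbow_card ct rT.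
  have : 5 <= #|vset (T i)| by apply: le => x xs; rewrite mem_enum sub.
  by move: t3; lia.
have clash i j x : i != j -> sub_adj (T i) (inr v) x -> sub_adj (T j) (inr v) x -> False.
  move=> /dis[/setP/(_ [set inr v; x]) + _] xi xj.
  by rewrite !inE [_ \in eset (T i)]xi [_ \in eset (T j)]xj.
pose i0 : 'I_3 := inord 0; pose i1 : 'I_3 := inord 1; pose i2 : 'I_3 := inord 2.
have d01 : i0 != i1 by rewrite -val_eqE /= !inordK.
have d02 : i0 != i2 by rewrite -val_eqE /= !inordK.
have d12 : i1 != i2 by rewrite -val_eqE /= !inordK.
by case/orP: (uses i0) => h0; case/orP: (uses i1) => h1; case/orP: (uses i2) => h2;
  try exact: clash d01 h0 h1; try exact: clash d02 h0 h2; try exact: clash d12 h1 h2.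
Qed.

(* By pigeonhole two rows agree on K * j columns; among these j have equal color. *)
Lemma monochromatic_K2j (j K : nat) (c : 'I_m -> 'I_n -> 'I_K) :
  0 < K -> K * j <= n -> K ^ (K * j) < m ->
  exists u1 u2 (Y : {set 'I_n}) d, [/\ u1 != u2, #|Y| = j &
    forall y, y \in Y -> c u1 y = d /\ c u2 y = d].
Proof.
move=> K0 Kjn Km.
pose col (y : 'I_(K * j)) := widen_ord Kjn y.
pose row u : {ffun 'I_(K * j) -> 'I_K} := [ffun y => c u (col y)].
have /injectivePn[u1 [u2 u12 /ffunP rowE]] : ~~ injectiveb row.
  apply/negP => /injectiveP/leq_card; rewrite card_ffun !card_ord; lia.
have [d dj] : exists d, j <= #|[set y | row u1 y == d]|.
  apply/existsP; apply: contraT; rewrite negb_exists => /forallP small.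
  have [j0|j0] := posnP j.
    by have := small (Ordinal K0); lia.
  have : #|'I_(K * j)| <= \sum_(d : 'I_K) j.-1.
    rewrite -sum1_card (partition_big (row u1) xpredT) //=.
    apply: leq_sum => d _; rewrite sum1dep_card.
    by rewrite -ltnS (prednK j0) ltnNge; apply: small.
  rewrite card_ord sum_nat_const card_ord leq_mul2l; lia.
have [Y Yd Yj] := exists_subset_card dj.
exists u1, u2, (col @: Y), d; split=> //.
  by rewrite card_imset // => y y' /(congr1 val) /= /val_inj.
move=> _ /imsetP[y /(subsetP Yd) yd ->]; have := rowE y.
by move: yd; rewrite inE !ffunE => /eqP-> <-.
Qed.

(** With at most [k] colors the tree has at most one vertex [w] outside [S]. Edges not inside [S]
    all meet [w], which has at most [k - 2] neighbors in [S], and at most one edge lies inside [S].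
    So there are at most [k - 1] edges, which leaves no room for [w]; then all edges lie inside [S],
    and one edge cannot connect [k] vertices. *)
Lemma succ_le_index (k l t : nat) :
  3 < k -> 0 < l -> k.+1 * (k - 2) <= n -> k.+1 ^ (k.+1 * (k - 2)) < m ->
  rainbow_colorable k l G t -> k.+1 <= t.
Proof.
move=> k3 l0 kn km /(rainbow_colorable_le l0)[c [ct col]].
rewrite leqNgt; apply/negP => tk.
(* Colors run from 1 to [t <= k], so [inord] does not alter them. *)
pose c' (u : 'I_m) (y : 'I_n) : 'I_k.+1 := inord (c (bip_edge (u, y))).
have [u1 [u2 [Y [d [u12 Yk mono]]]]] := monochromatic_K2j c' isT kn km.
have cE u y : val (c' u y) = c (bip_edge (u, y)).
  by rewrite /= inordK //; have /ct := bip_edge_edges (u, y); lia.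
pose L : {set G} := [set inl u1; inl u2]; pose R : {set G} := inr @: Y.
have Sk : #|L :|: R| = k.
  rewrite cardsU disjoint_setI0 ?cards0.
    by rewrite cards2 (inj_eq inl_inj) u12 card_imset ?Yk; [lia | apply: inr_inj].
  by apply/pred0P => x /=; apply/negP => /andP[xL /imsetP[y _ E]]; rewrite E !inE in xL.
have [T [/(_ ord0)[[conT _] ST rT] _]] := col _ Sk.
move: (T ord0) conT ST rT => {}T conT ST rT.
have eT := rainbow_card ct rT; have vT := connected_card conT.
have edgeT e : e \in eset T ->
    exists a b, [/\ e = bip_edge (a, b), inl a \in vset T & inr b \in vset T].
  move=> eT'; have /edgesP[[a b] E] := subsetP (eset_edges T) _ eT'.
  have /subsetP sub := eset_vset eT'.
  by exists a, b; split=> //; apply: sub; rewrite E in_bip_edge /= eqxx.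
pose inner : {set {set G}} := [set e in eset T | e \subset L :|: R].
have inner1 : #|inner| <= 1.
  have colS e : e \in inner -> c e = val d.
    rewrite inE => /andP[/edgeT[a [b [-> _ _]]] /subsetP sub].
    have := sub (inl a); have := sub (inr b); rewrite !in_bip_edge /= !eqxx.
    move=> /(_ isT) /setUP[|/imsetP[y yY [->]]]; first by rewrite !inE.
    move=> /(_ isT) /setUP[|/imsetP[]] //; have [m1 m2] := mono y yY.
    by rewrite !inE -cE => /orP[]/eqP[->]; rewrite ?m1 ?m2.
  apply/card_le1_eqP => e e' eI e'I; apply: rT; rewrite ?colS //.
    by move: e'I; rewrite inE => /andP[].
  by move: eI; rewrite inE => /andP[].
have outer_le : #|eset T :\: inner| <= k - 2.
  have outerP e : e \in eset T :\: inner -> exists a b,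
      [/\ e = bip_edge (a, b), inl a \in vset T, inr b \in vset T &
          ~~ ((inl a \in L :|: R) && (inr b \in L :|: R))].
    rewrite !inE andbC => /andP[eE]; rewrite eE /= => notsub.
    have [a [b [E aT bT]]] := edgeT e eE; exists a, b; split=> //.
    apply: contra notsub => /andP[aS bS]; rewrite E.
    by apply/subsetP => x; rewrite in_bip_edge; case: x => ? /eqP->.
  have [VS|/subsetPn[w wT wS]] := boolP (vset T \subset L :|: R).
    rewrite [_ :\: _](_ : _ = set0) ?cards0 //; apply/setP => e; rewrite in_set0.
    apply/negP => /outerP[a [b [_ aT bT]]].
    by rewrite !(subsetP VS).
  have wV : vset T = w |: (L :|: R).
    apply/esym/eqP; rewrite eqEcard subUset sub1set wT ST cardsU1 wS Sk.
    by apply: leq_trans vT _; lia.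
  case: w wT wS wV => [a|b] wT wS wV.
    apply: leq_trans (_ : #|(fun y => bip_edge (a, y)) @: Y| <= _).
      apply/subset_leq_card/subsetP => e /outerP[a' [b' [-> + +]]].
      rewrite wV in_setU1 => /predU1P[[->]|aS].
        rewrite in_setU1 /= => /setUP[|/imsetP[y yY [->]] _]; first by rewrite !inE.
        by apply/imsetP; exists y.
      by rewrite in_setU1 /= aS => ->.
    by rewrite (leq_trans (leq_imset_card _ _)) // Yk.
  (* Here [w] is in the class of [Y] and sees only [u1] and [u2]; the bound [2 <= k - 2] is where
     [k >= 4] enters. *)
  apply: leq_trans (_ : #|(fun u => bip_edge (u, b)) @: [set u1; u2]| <= _).
    apply/subset_leq_card/subsetP => e /outerP[a' [b' [-> + +]]].
    rewrite wV !in_setU1 /= => aS /predU1P[[->] _|bS]; last by rewrite aS bS.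
    apply/imsetP; exists a' => //; case/setUP: aS => [|/imsetP[]] //.
    by rewrite !inE.
  by rewrite (leq_trans (leq_imset_card _ _)) // cards2; case: eqP; lia.
have eT' : #|eset T| <= k - 1.
  by rewrite -(cardsID inner); have := subset_leq_card (subsetIr (eset T) inner); lia.
have VS : vset T = L :|: R.
  by apply/esym/eqP; rewrite eqEcard ST Sk; lia.
have : #|eset T| <= #|inner|.
  apply/subset_leq_card/subsetP => e eE; rewrite inE eE -VS.
  exact: eset_vset eE.
by move: vT; rewrite VS Sk; lia.
Qed.
End LowerBounds.

(** * The rainbow index *)

(** The double stars with [k.+1] colors give the upper bound also for [k = 3] and [l >= 3], where
    [k.+1] is 4; only [l <= 2] calls for the three-color packing. *)
Lemma rainbow_index_bipartite (k l D : nat) : 3 <= k -> 0 < l ->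
  exists N, forall m n, N <= n -> n <= m -> m <= n ^ D ->
    is_rainbow_index k l (complete_bipartite m n)
      (if k == 3 then (if l <= 2 then 3 else 4) else k.+1).
Proof.
move=> k3 l0.
have [N1 H1] := exists_universal_ord k k.+1 (k + l) D.
have [N2 H2] := exists_universal_ord 2 3 2 D.
(* The middle terms are the sizes that force a monochromatic [K_{2,k-2}]; the last one covers the
   small vertex sets of the bounds for [k = 3]. *)
exists (N1 + N2 + k.+1 * (k - 2) + k.+1 ^ (k.+1 * (k - 2)) + 4) => m n nN nm mn.
have upper : rainbow_colorable k l (complete_bipartite m n) k.+1.
  have [|c [Uc Uc']] := H1 m n _ nm mn; first lia.
  by apply: (rainbow_colorable_packing (c := c)) => S Sk; apply: packing_universal.
case: eqP => [k_3|k_3]; last first.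
  by split=> // t; apply: succ_le_index => //; lia.
subst k; case: ifP => l2; last first.
  by split=> // t; apply: four_le_index; lia.
split; last by move=> t; apply: three_le_index; lia.
have [|c [Uc Uc']] := H2 m n _ nm mn; first lia.
apply: (rainbow_colorable_packing (c := c)) => S S3.
by apply: packing_le l2 _; apply: packing_three_colors.
Qed.

Import Order.TTheory GRing.Theory Num.Theory.
Local Open Scope ring_scope.

(** The exponent is rounded up to an integer, and one further factor [n] absorbs the constant once
    [n] exceeds [C]. *)
Lemma le_expn_of_powR (R : realType) (alpha C : R) : 0 <= alpha -> 0 <= C ->
  exists N D : nat, forall m n : nat,
    (N <= n)%N -> m%:R <= C * (n%:R `^ alpha) -> (m <= n ^ D)%N.
Proof.
move=> alpha0 C0; pose a := Num.bound alpha; pose b := Num.bound C.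
exists b.+1, a.+1 => m n bn le; rewrite -(ler_nat R) (le_trans le) //.
rewrite expnS natrM natrX; apply: ler_pM; rewrite ?powR_ge0 //.
  by rewrite (le_trans (ltW (archi_boundP C0))) // ler_nat ltnW.
rewrite -powR_mulrn ?ler0n //; apply: ler_powR; last exact: ltW (archi_boundP alpha0).
by rewrite ler1n; apply: leq_trans bn.
Qed.

Unset Implicit Arguments.

(** The assumption [n <= m] makes [m] large together with [n]. The formula fails for [K_{1,n}] with
    [l = 1]: a tree through [k] leaves contains all their edges, so any two edges need different
    colors and the index is [n]. *)
Theorem corollary2p5 (R : realType) (alpha C : R)
    (halpha : 1 <= alpha) (hC : 0 < C)
    (k l : nat) (hk : (3 <= k)%N) (hl : (1 <= l)%N) :
  exists N : nat, (0 < N)%N /\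
    forall m n : nat, (0 < m)%N -> (0 < n)%N -> (n <= m)%N ->
      m%:R <= C * (n%:R `^ alpha) -> (N <= n)%N ->
      is_rainbow_index k l (complete_bipartite m n)
        (if (k == 3)%N then (if (l <= 2)%N then 3%N else 4%N) else k.+1).
Proof.
have [N1 [D bound]] := le_expn_of_powR (le_trans ler01 halpha) (ltW hC).
have [N2 index] := rainbow_index_bipartite D hk hl.
exists (N1 + N2).+1; split=> // m n _ _ nm mC Nn.
apply: index => //; last apply: bound mC; lia.
Qed.
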